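(* Let $M$ be a commutative binoid. The canonical binoid epimorphism $\beta:M\to\mathcal B(M)$, $f\mapsto D(f)$, induces a continuous semigroup isomorphism $$\beta^*:\mathrm{spec}\,\mathcal B(M)\to\mathrm{spec}\,M,\qquad Q\mapsto\beta^{-1}(Q).$$
   Context: A commutative binoid is a commutative monoid $(M,+,0)$ with an absorbing element $\infty$ ($a+\infty=\infty$); homomorphisms are monoid homomorphisms with $\infty\mapsto\infty$. An ideal of $M$ is a subset $I$ with $\infty\in I$ and $I+M\subseteq I$; a prime ideal is an ideal $P\ne M$ such that $M\setminus P$ is a submonoid. $\mathrm{spec}\,M$ is the set of prime ideals; it is a semigroup under union, and a topological space with the Zariski topology, whose basic open sets are $D(f)=\{P\in\mathrm{spec}\,M\mid f\notin P\}$, $f\in M$. One has $D(f)\cap D(g)=D(f+g)$, and $\mathcal B(M)=\{D(f)\mid f\in M\}$ is a binoid with operation $\cap$, identity element $\mathrm{spec}\,M=D(0)$ and absorbing element $\emptyset=D(\infty)$ (the booleanization of $M$). *)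

(* Defs.v *)
From HB Require Import structures.
From mathcomp Require Import all_boot all_order all_algebra.
From mathcomp Require Import all_classical topology.

Set Implicit Arguments.
Unset Strict Implicit.
Unset Printing Implicit Defensive.

Import GRing.Theory.
Local Open Scope classical_set_scope.
Local Open Scope ring_scope.

HB.mixin Record Nmodule_isComBinoid M of GRing.Nmodule M := {
  absorb : M;
  addr_absorb : forall a : M, a + absorb = absorb
}.

#[short(type="comBinoidType")]
HB.structure Definition ComBinoid :=
  {M of Nmodule_isComBinoid M & GRing.Nmodule M}.

HB.mixin Record Additive_isComBinoidMorphism (M N : comBinoidType)
    (f : M -> N) of @GRing.Additive M N f := {
  absorb_morphism : f absorb = absorb
}.

HB.structure Definition ComBinoidMorphism (M N : comBinoidType) :=
  {f of Additive_isComBinoidMorphism M N f & @GRing.Additive M N f}.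

Notation "{ 'binoid_morphism' M -> N }" := (ComBinoidMorphism.type M N)
  (at level 0, M at level 98, N at level 99,
   format "{ 'binoid_morphism'  M  ->  N }") : type_scope.

Section Ideals.
Variable M : comBinoidType.

Definition binoid_ideal (I : set M) : Prop :=
  I absorb /\ forall a b, I a -> I (a + b).

Definition submonoid (S : set M) : Prop :=
  S 0 /\ forall a b, S a -> S b -> S (a + b).

Definition prime_ideal (P : set M) : Prop :=
  [/\ binoid_ideal P, P <> setT & submonoid (~` P)].

Lemma prime_idealU (P Q : set M) :
  prime_ideal P -> prime_ideal Q -> prime_ideal (P `|` Q).
Proof.
move=> [[Py Pi] _ [P0 Pa]] [[Qy Qi] _ [Q0 Qa]]; split.
- split; first by left.
  by move=> a b [Pa'|Qa']; [left; exact: Pi|right; exact: Qi].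
- by move=> PQT; have [] : (P `|` Q) 0 by rewrite PQT.
- split; first by rewrite setCU; split.
  by rewrite setCU => a b [? ?] [? ?]; split; [exact: Pa|exact: Qa].
Qed.

End Ideals.

Lemma prime_ideal_preimage (M N : comBinoidType) (f : {binoid_morphism M -> N})
  (Q : set N) : prime_ideal Q -> prime_ideal (f @^-1` Q).
Proof.
move=> [[Qy Qi] _ [Q0 Qa]]; split.
- split; first by rewrite /preimage /= absorb_morphism.
  by move=> a b; rewrite /preimage /= raddfD; exact: Qi.
- move=> QT; apply: Q0; rewrite -(raddf0 f).
  by have : (f @^-1` Q) 0 by rewrite QT.
- split; first by rewrite /setC /preimage /= raddf0.
  by move=> a b; rewrite /setC /preimage /= raddfD; exact: Qa.
Qed.

Definition spec (M : comBinoidType) : Type :=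
  set_type [set P : set M | prime_ideal P].

HB.instance Definition _ (M : comBinoidType) := Choice.on (spec M).

Definition spec_set (M : comBinoidType) (P : spec M) : set M := val P.
Coercion spec_set : spec >-> set.

Section Spec.
Variable M : comBinoidType.
Implicit Types P Q : spec M.

Lemma spec_prime P : prime_ideal P.
Proof. exact: set_mem (valP P). Qed.

Definition mkspec (P : set M) (hP : prime_ideal P) : spec M :=
  exist _ P (mem_set hP).

Lemma spec_inj P Q : P = Q :> set M -> P = Q.
Proof. exact: val_inj. Qed.

Definition specU P Q : spec M :=
  mkspec (prime_idealU (spec_prime P) (spec_prime Q)).

Lemma specUC : commutative specU.
Proof. by move=> P Q; apply: spec_inj; exact: setUC. Qed.

Lemma specUA : associative specU.
Proof. by move=> P Q R; apply: spec_inj; exact: setUA. Qed.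

(* On [spec M], the addition [+] is the union of prime ideals. *)
HB.instance Definition _ := Algebra.isAddSemigroup.Build (spec M) specUC specUA.

Definition basic_open (f : M) : set (spec M) := [set P | ~ (P : set M) f].

Lemma basic_openD f g : basic_open (f + g) = basic_open f `&` basic_open g.
Proof.
apply/seteqP; split=> P; have [[_ Pi] _ [_ Pa]] := spec_prime P.
- move=> Pfg; split=> [Pf|Pg]; apply: Pfg; first exact: Pi.
  by rewrite addrC; exact: Pi.
- by case; exact: Pa.
Qed.

Lemma basic_open0 : basic_open 0 = setT.
Proof.
by apply/seteqP; split=> // P _; have [_ _ []] := spec_prime P.
Qed.

Lemma basic_open_absorb : basic_open absorb = set0.
Proof.
by apply/seteqP; split=> // P; have [[Py _] _ _] := spec_prime P; exact.
Qed.

Definition zariski_open (U : set (spec M)) : Prop :=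
  exists F : set M, U = \bigcup_(f in F) basic_open f.

Lemma zariski_openT : zariski_open setT.
Proof. by exists [set 0]; rewrite bigcup_set1 basic_open0. Qed.

Lemma zariski_openI (U V : set (spec M)) :
  zariski_open U -> zariski_open V -> zariski_open (U `&` V).
Proof.
move=> [F ->] [G ->]; exists [set f + g | f in F & g in G].
apply/seteqP; split=> P.
- move=> [[f Ff Pf] [g Gg Pg]]; exists (f + g); last by rewrite basic_openD.
  by exists f => //; exists g.
- by move=> [_ [f Ff [g Gg <-]]]; rewrite basic_openD => -[Pf Pg];
    split; [exists f|exists g].
Qed.

Lemma zariski_open_bigcup (I : Type) (U : I -> set (spec M)) :
  (forall i, zariski_open (U i)) -> zariski_open (\bigcup_i U i).
Proof.
move=> /choice[F UF]; exists (\bigcup_i F i).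
by rewrite bigcup_bigcup; apply: eq_bigcupr => i _; exact: UF.
Qed.

HB.instance Definition _ := isOpenTopological.Build (spec M)
  zariski_openT zariski_openI zariski_open_bigcup.

Definition booleanization : Type := set_type (range basic_open).

HB.instance Definition _ := Choice.on booleanization.

Definition mkbool (U : set (spec M)) (hU : range basic_open U) :
  booleanization := exist _ U (mem_set hU).

Definition booleanize (f : M) : booleanization := mkbool (imageT basic_open f).

Lemma bool_range (U : booleanization) : range basic_open (val U).
Proof. exact: set_mem (valP U). Qed.

Lemma boolI_subproof (U V : booleanization) :
  range basic_open (val U `&` val V).
Proof.
have [[f _ <-] [g _ <-]] := (bool_range U, bool_range V).
by exists (f + g) => //; exact: basic_openD.
Qed.

Definition boolI (U V : booleanization) : booleanization :=
  mkbool (boolI_subproof U V).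

Lemma boolIA : associative boolI.
Proof. by move=> U V W; apply: val_inj; exact: setIA. Qed.

Lemma boolIC : commutative boolI.
Proof. by move=> U V; apply: val_inj; exact: setIC. Qed.

Lemma boolTI : left_id (booleanize 0) boolI.
Proof. by move=> U; apply: val_inj; rewrite /= basic_open0 setTI. Qed.

(* On [booleanization], [+] is the intersection and [0] is [D(0) = spec M]. *)
HB.instance Definition _ :=
  GRing.isNmodule.Build booleanization boolIA boolIC boolTI.

Lemma boolI0 (U : booleanization) : U + booleanize absorb = booleanize absorb.
Proof. by apply: val_inj; rewrite /= basic_open_absorb setI0. Qed.

HB.instance Definition _ :=
  Nmodule_isComBinoid.Build booleanization boolI0.

Lemma booleanize_is_nmod_morphism : nmod_morphism booleanize.
Proof. by split=> // f g; apply: val_inj; exact: basic_openD. Qed.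

HB.instance Definition _ := GRing.isNmodMorphism.Build M booleanization
  booleanize booleanize_is_nmod_morphism.

Lemma booleanize_absorb : booleanize absorb = absorb.
Proof. by []. Qed.

HB.instance Definition _ := Additive_isComBinoidMorphism.Build
  M booleanization booleanize booleanize_absorb.

End Spec.

Definition spec_map (M N : comBinoidType) (f : {binoid_morphism M -> N})
  (Q : spec N) : spec M := mkspec (prime_ideal_preimage f (spec_prime Q)).

(* Main.v *)
Require Import Defs.
From HB Require Import structures.
From mathcomp Require Import all_boot all_order all_algebra.
From mathcomp Require Import all_classical topology.
Local Open Scope classical_set_scope.
Local Open Scope ring_scope.

(** The inverse of [beta_star] sends a prime [P] to the family of all [D(f)]
    that do not contain the point [P]; as [P \notin D(f)] iff [f \in P], pulling
    this family back along [beta] returns [P]. *)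

Lemma booleanize_surj (M : comBinoidType) (U : booleanization M) :
  exists f : M, booleanize f = U.
Proof. by have [f _ fU] := bool_range U; exists f; exact: val_inj. Qed.

Lemma spec_mapU (M N : comBinoidType) (f : {binoid_morphism M -> N}) :
  {morph spec_map f : P Q / P + Q}.
Proof. by move=> P Q; apply: spec_inj. Qed.

(** Both sides unfold to [~ Q (f a)] at a prime [Q]. *)
Lemma spec_map_basic_open (M N : comBinoidType) (f : {binoid_morphism M -> N})
  (a : M) : spec_map f @^-1` basic_open a = basic_open (f a).
Proof. by []. Qed.

Lemma spec_map_continuous (M N : comBinoidType) (f : {binoid_morphism M -> N}) :
  continuous (spec_map f).
Proof.
(* An open set is a union of sets [basic_open a] with [a] in [F]; its preimage is the union of the
   [basic_open (f a)], hence is indexed by the image of [F]. *)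
apply/continuousP => _ [F ->]; exists (f @` F).
rewrite preimage_bigcup bigcup_image.
by apply: eq_bigcupr => a _; exact: spec_map_basic_open.
Qed.

(** Membership of the point [P] turns intersection into conjunction, holds for [spec M] and fails
    for the empty set. *)
Lemma prime_ideal_avoiding (M : comBinoidType) (P : spec M) :
  prime_ideal [set U : booleanization M | ~ val U P].
Proof.
have T0 : val (0 : booleanization M) P by rewrite /= basic_open0.
split.
- split; first by rewrite /= basic_open_absorb.
  by move=> U V /= nUP [/nUP].
- move=> eqT; have : [set U : booleanization M | ~ val U P] 0 by rewrite eqT.
  exact.
- split; first exact.
  (* Lying outside the family is a double negation of [val U P]. *)
  by move=> U V /contrapT UP /contrapT VP; apply.
Qed.

Definition spec_booleanize (M : comBinoidType) (P : spec M) :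
  spec (booleanization M) := mkspec (prime_ideal_avoiding M P).

Lemma spec_booleanizeK (M : comBinoidType) :
  cancel (@spec_booleanize M) (spec_map (@booleanize M)).
Proof.
move=> P; apply: spec_inj; apply/seteqP; split=> f /=; first exact: contrapT.
by move=> Pf; apply.
Qed.

(** As [booleanize] is surjective, [Q] is determined by its preimage: it suffices to test membership
    on sets of the form [booleanize f]. *)
Lemma spec_map_booleanizeK (M : comBinoidType) :
  cancel (spec_map (@booleanize M)) (@spec_booleanize M).
Proof.
move=> Q; apply: spec_inj; apply/seteqP; split=> U /=;
  have [f <-] := booleanize_surj _ U; first exact: contrapT.
by move=> Qf; apply.
Qed.

Theorem corollary4p2p7 (M : comBinoidType) :
  let beta : {binoid_morphism M -> booleanization M} := @booleanize M in
  let beta_star : spec (booleanization M) -> spec M := spec_map beta in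
  [/\ forall U : booleanization M, exists f : M, beta f = U,
      bijective beta_star,
      {morph beta_star : P Q / P + Q} &
      continuous beta_star].
Proof.
move=> beta beta_star; split.
- exact: booleanize_surj.
- exists (@spec_booleanize M); last exact: spec_booleanizeK.
  exact: spec_map_booleanizeK.
- exact: spec_mapU.
- exact: spec_map_continuous.
Qed.
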